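(* Let $X$ be a compact connected Riemann surface of genus $g\geq 1$, let $\mathcal{M}_R=\operatorname{Hom}(\pi_1(X),\mathbb{C}^* )=\operatorname{Hom}(H_1(X,\mathbb{Z}),\mathbb{C}^* )$, and let $\Gamma$ be the group of automorphisms of the $\mathbb{Z}$-module $H_1(X,\mathbb{Z})$. Then the group $\operatorname{Aut}(\mathcal{M}_R)$ of algebraic automorphisms of the variety $\mathcal{M}_R$ is the semi-direct product $\mathcal{M}_R\rtimes\Gamma$.
   Context: $\mathbb{C}^*=\mathbb{C}\setminus\{0\}$ is the multiplicative group. A choice of basis of $H_1(X,\mathbb{Z})\cong\mathbb{Z}^{2g}$ gives an isomorphism of algebraic groups $\mathcal{M}_R\cong(\mathbb{C}^* )^{2g}$, and $\Gamma\cong \mathrm{GL}(2g,\mathbb{Z})$. Elements of $\operatorname{Aut}(\mathcal{M}_R)$ are automorphisms of the algebraic variety, not necessarily group homomorphisms. In the semi-direct product, the normal factor $\mathcal{M}_R$ acts on the variety $\mathcal{M}_R$ by translations, and $\Gamma$ acts by algebraic group automorphisms, through its natural action on $\operatorname{Hom}(H_1(X,\mathbb{Z}),\mathbb{C}^* )$, i.e. $\gamma\cdot\chi=\chi\circ\gamma^{-1}$ (in coordinates, by monomial maps $(z_1,\dots,z_{2g})\mapsto\left(\prod_j z_j^{a_{ij}}\right)_i$ with $(a_{ij})\in \mathrm{GL}(2g,\mathbb{Z})$). *)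

(* Defs.v *)
From HB Require Import structures.
From mathcomp Require Import all_boot all_order all_algebra.
From mathcomp Require Import all_classical reals topology normedtype derive.
From mathcomp Require Import complex.
From mathcomp.multinomials Require Import freeg.
Import numFieldNormedType.Exports.
Import GRing.Theory Num.Theory.

Set Implicit Arguments.
Unset Strict Implicit.
Unset Printing Implicit Defensive.

Local Open Scope classical_set_scope.
Local Open Scope ring_scope.

Section RiemannSurface.
Variable R : realType.
Local Notation C := (R[i]).

(* Holomorphic on U; meant for open U.  [C^o] is C as a normed module over
   itself, so that [derivable _ z 1] is complex differentiability at [z]. *)
Definition holomorphic_on (U : set C^o) (f : C^o -> C^o) : Prop :=
  forall z, U z -> derivable f z 1.

(* A homeomorphism from an open subset of X onto an open subset of C; the
   values of [chart_fun] and [chart_inv] off these subsets are irrelevant. *)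
Record chart (X : topologicalType) := Chart {
  chart_dom : set X;
  chart_fun : X -> C^o;
  chart_inv : C^o -> X;
  chart_dom_open : open chart_dom;
  chart_img_open : open (chart_fun @` chart_dom);
  chart_fun_cts : {within chart_dom, continuous chart_fun};
  chart_inv_cts : {within chart_fun @` chart_dom, continuous chart_inv};
  chart_funK : forall x, chart_dom x -> chart_inv (chart_fun x) = x }.

Definition chart_compatible (X : topologicalType) (c d : chart X) : Prop :=
  holomorphic_on (chart_fun c @` (chart_dom c `&` chart_dom d))
                 (chart_fun d \o chart_inv c).

Record riemann_surface := RiemannSurface {
  surface_space :> topologicalType;
  surface_hausdorff : hausdorff_space surface_space;
  atlas : set (chart surface_space);
  atlas_cover : forall x, exists2 c, atlas c & chart_dom c x;
  atlas_compatible :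
    forall c d, atlas c -> atlas d -> chart_compatible c d }.

End RiemannSurface.

Section SingularHomology.
Variable R : realType.

Definition std_simplex (n : nat) : set 'rV[R]_n.+1 :=
  [set t | (forall i, 0 <= t 0 i) /\ \sum_i t 0 i = 1].
Arguments std_simplex : clear implicits.

(* The i-th face inclusion: insert a zero coordinate at position i. *)
Definition face_row n (i : 'I_n.+2) (t : 'rV[R]_n.+1) : 'rV[R]_n.+2 :=
  \row_j (if unlift i j is Some k then t 0 k else 0).

Lemma face_row_lift n (i : 'I_n.+2) t k : face_row i t 0 (fintype.lift i k) = t 0 k.
Proof. by rewrite mxE liftK. Qed.

Lemma face_row_simplex n (i : 'I_n.+2) t :
  std_simplex n t -> std_simplex n.+1 (face_row i t).
Proof.
case=> t0 t1; split.
  by move=> j; rewrite mxE; case: unlift.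
rewrite (bigD1_ord i) //= [face_row i t 0 i]mxE unlift_none add0r -[RHS]t1.
by apply: eq_bigr => k _; rewrite face_row_lift.
Qed.

Lemma face_row_continuous n (i : 'I_n.+2) : continuous (@face_row n i).
Proof.
move=> t A [P nP PA].
exists (fun r k => P r (fintype.lift i k)) => [r k|s sP].
  by have := nP r (fintype.lift i k); rewrite ord1 face_row_lift.
apply: PA => r j; rewrite ord1; case: (unliftP i j) => [k ->|->].
  by rewrite face_row_lift; exact: sP.
have := nbhs_singleton (nP 0 i); rewrite !mxE unlift_none; exact.
Qed.

Definition face n (i : 'I_n.+2) (t : std_simplex n) : std_simplex n.+1 :=
  exist _ (face_row i (set_val t)) (mem_set (face_row_simplex i (set_valP t))).

Lemma face_continuous n (i : 'I_n.+2) : continuous (@face n i).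
Proof.
apply: continuous_comp_initial => t.
apply: (@continuous_comp _ _ _ set_val (face_row i)).
  exact: initial_continuous.
exact: face_row_continuous.
Qed.

Section Chains.
Variable X : topologicalType.

Definition singular_simplex n := continuousType (std_simplex n) X.

Definition simplex_face n (i : 'I_n.+2) (s : singular_simplex n.+1) :
    singular_simplex n :=
  mkcts (fun t => continuous_comp (@face_continuous n i t) (@cts_fun _ _ s _)).

Definition chain n := {freeg (singular_simplex n) / int}.

Definition boundary n : chain n.+1 -> chain n :=
  fglift (fun s => \sum_(i < n.+2) (-1) ^+ i *: << simplex_face i s >>).

Lemma boundaryB n : {morph @boundary n : a b / a - b}.
Proof. exact: lift_is_additive. Qed.

Lemma boundary0 n : boundary (0 : chain n.+1) = 0.
Proof. by rewrite -(subrr 0) boundaryB subrr. Qed.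

Definition cycle_pred : {pred chain 1} := [pred c | boundary c == 0].

Lemma cycle_pred_zmod : zmod_closed cycle_pred.
Proof.
split=> [|a b]; rewrite !inE ?boundary0 // boundaryB => /eqP -> /eqP ->.
by rewrite subrr.
Qed.

HB.instance Definition _ := GRing.isZmodClosed.Build (chain 1) cycle_pred
  cycle_pred_zmod.

Record cycle1 := Cycle1 { cycle1_val : chain 1; _ : cycle1_val \in cycle_pred }.
HB.instance Definition _ := [isSub for cycle1_val].
HB.instance Definition _ := [Choice of cycle1 by <:].
HB.instance Definition _ := [SubChoice_isSubZmodule of cycle1 by <:].

Definition boundary_pred : {pred cycle1} :=
  [pred z | `[< exists b : chain 2, val z = boundary b >]].

Lemma boundary_pred_zmod : zmod_closed boundary_pred.
Proof.
split=> [|a b].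
  apply/asboolP; exists 0; rewrite boundary0; exact: raddf0.
move=> /asboolP[x ax] /asboolP[y by_]; apply/asboolP; exists (x - y).
by rewrite boundaryB -ax -by_ raddfB.
Qed.

HB.instance Definition _ := GRing.isZmodClosed.Build cycle1 boundary_pred
  boundary_pred_zmod.

Definition H1 : zmodType := Quotient.quot boundary_pred.

End Chains.
End SingularHomology.

(* The genus of a compact connected Riemann surface, defined topologically:
   H_1(X, Z) is free of rank 2g. *)
Definition has_genus (R : realType) (X : riemann_surface R) (g : nat) : Prop :=
  exists f : {additive H1 R X -> 'rV[int]_(2 * g)}, bijective f.

Section Bijections.
Variable T : Type.

Record bij := Bij {
  bij_fun :> T -> T;
  bij_inv : T -> T;
  bij_funK : cancel bij_fun bij_inv;
  bij_invK : cancel bij_inv bij_fun }.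

Lemma bijP (f g : bij) : f =1 g -> f = g.
Proof.
case: f g => [f f' fK f'K] [g g' gK g'K] /= /funext fg.
rewrite -{g}fg in gK g'K *.
have fg' : f' = g' by apply/funext => x; rewrite -[x]g'K fK gK.
rewrite -{g'}fg' in gK g'K *.
by rewrite (Prop_irrelevance gK fK) (Prop_irrelevance g'K f'K).
Qed.

HB.instance Definition _ := gen_eqMixin bij.
HB.instance Definition _ := gen_choiceMixin bij.

Definition bij_one := @Bij id id (fun=> erefl) (fun=> erefl).
Definition bij_sym (f : bij) := Bij (bij_invK f) (bij_funK f).
Definition bij_mul (f g : bij) :=
  Bij (can_comp (bij_funK f) (bij_funK g)) (can_comp (bij_invK g) (bij_invK f)).

Fact bij_mulA : associative bij_mul. Proof. by move=> f g h; exact: bijP. Qed.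
Fact bij_mul1 : left_id bij_one bij_mul. Proof. by move=> f; exact: bijP. Qed.
Fact bij_1mul : right_id bij_one bij_mul. Proof. by move=> f; exact: bijP. Qed.
Fact bij_mulV : left_inverse bij_one bij_sym bij_mul.
Proof. by move=> f; apply: bijP => x /=; rewrite bij_funK. Qed.
Fact bij_Vmul : right_inverse bij_one bij_sym bij_mul.
Proof. by move=> f; apply: bijP => x /=; rewrite bij_invK. Qed.

HB.instance Definition _ :=
  isGroup.Build bij bij_mulA bij_mul1 bij_1mul bij_mulV bij_Vmul.

End Bijections.

Section GroupAutomorphisms.
Variable N : groupType.

Definition group_aut_pred : {pred bij N} :=
  [pred f : bij N | `[< {morph f : x y / (x * y)%g} >]].

Lemma group_aut_closed : group_closed group_aut_pred.
Proof.
split=> [|f g]; first by apply/asboolP.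
move=> /asboolP fM /asboolP gM; apply/asboolP => x y /=.
by rewrite -fM; congr (f _); apply: (can_inj (bij_funK g)); rewrite gM !bij_invK.
Qed.

Record group_aut :=
  GroupAut { group_aut_bij :> bij N; _ : group_aut_bij \in group_aut_pred }.
HB.instance Definition _ := [isSub for group_aut_bij].
HB.instance Definition _ := [Choice of group_aut by <:].
HB.instance Definition _ :=
  SubChoice_isSubGroup.Build _ _ group_aut group_aut_closed.

Lemma group_autM (f : group_aut) : {morph f : x y / (x * y)%g}.
Proof. exact/asboolP/(valP f). Qed.

Lemma group_aut1 (f : group_aut) : f 1%g = 1%g.
Proof. by apply: (mulgI (f 1%g)); rewrite -group_autM !mulg1. Qed.

End GroupAutomorphisms.

Record semidirect (N G : groupType) (phi : {multiplicative G -> group_aut N}) :=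
  SemiDirect { sd_l : N; sd_r : G }.

Section SemidirectProduct.
Variables (N G : groupType) (phi : {multiplicative G -> group_aut N}).
Local Notation sdprod := (semidirect phi).
Local Notation SDProd := (SemiDirect phi).

HB.instance Definition _ := gen_eqMixin sdprod.
HB.instance Definition _ := gen_choiceMixin sdprod.

Definition sd_one := SDProd 1%g 1%g.
Definition sd_mul (s t : sdprod) :=
  SDProd (sd_l s * phi (sd_r s) (sd_l t))%g (sd_r s * sd_r t)%g.
Definition sd_inv (s : sdprod) :=
  SDProd (phi (sd_r s)^-1 (sd_l s)^-1)%g (sd_r s)^-1%g.

Lemma sd_phi1 x : phi 1%g x = x.
Proof.
suff -> : phi 1%g = 1%g by [].
by apply: (mulgI (phi 1%g)); rewrite -gmulfM !mulg1.
Qed.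

Lemma sd_phiM a b x : phi (a * b)%g x = phi a (phi b x).
Proof. by rewrite gmulfM. Qed.

Fact sd_mulA : associative sd_mul.
Proof.
by move=> s t u; rewrite /sd_mul /= group_autM sd_phiM !mulgA.
Qed.
Fact sd_mul1 : left_id sd_one sd_mul.
Proof. by case=> n g; rewrite /sd_mul /= sd_phi1 !mul1g. Qed.
Fact sd_1mul : right_id sd_one sd_mul.
Proof. by case=> n g; rewrite /sd_mul /= group_aut1 !mulg1. Qed.
Fact sd_mulV : left_inverse sd_one sd_inv sd_mul.
Proof.
by case=> n g; rewrite /sd_mul /= -group_autM !mulVg group_aut1.
Qed.
Fact sd_Vmul : right_inverse sd_one sd_inv sd_mul.
Proof. by case=> n g; rewrite /sd_mul /= -sd_phiM !mulgV sd_phi1 mulgV. Qed.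

HB.instance Definition _ :=
  isGroup.Build sdprod sd_mulA sd_mul1 sd_1mul sd_mulV sd_Vmul.

End SemidirectProduct.

Section CharacterVariety.
Variables (C : fieldType) (H : zmodType).

(* Hom(H, C^* ), its elements seen as functions into C. *)
Record charvar := CharVar {
  char_fun :> H -> C;
  char_neq0 : forall a, char_fun a != 0;
  charD : forall a b, char_fun (a + b) = char_fun a * char_fun b }.

Lemma charvarP (x y : charvar) : x =1 y -> x = y.
Proof.
case: x y => [x x0 xD] [y y0 yD] /= /funext xy.
rewrite -{y}xy in y0 yD *.
by rewrite (Prop_irrelevance y0 x0) (Prop_irrelevance yD xD).
Qed.

HB.instance Definition _ := gen_eqMixin charvar.
HB.instance Definition _ := gen_choiceMixin charvar.

Fact char_one_neq0 (a : H) : (1 : C) != 0. Proof. exact: oner_neq0. Qed.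
Fact char_oneD (a b : H) : (1 : C) = 1 * 1. Proof. by rewrite mulr1. Qed.
Definition char_one := CharVar char_one_neq0 char_oneD.

Fact char_mul_neq0 (x y : charvar) a : x a * y a != 0.
Proof. by rewrite mulf_neq0 ?char_neq0. Qed.
Fact char_mulD (x y : charvar) a b :
  x (a + b) * y (a + b) = (x a * y a) * (x b * y b).
Proof. by rewrite !charD mulrACA. Qed.
Definition char_mul (x y : charvar) :=
  @CharVar (fun a => x a * y a) (char_mul_neq0 x y) (char_mulD x y).

Fact char_inv_neq0 (x : charvar) a : (x a)^-1 != 0.
Proof. by rewrite invr_eq0 char_neq0. Qed.
Fact char_invD (x : charvar) a b : (x (a + b))^-1 = (x a)^-1 * (x b)^-1.
Proof. by rewrite charD invfM. Qed.
Definition char_inv (x : charvar) :=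
  @CharVar (fun a => (x a)^-1) (char_inv_neq0 x) (char_invD x).

Fact char_mulA : associative char_mul.
Proof. by move=> x y z; apply: charvarP => a /=; rewrite mulrA. Qed.
Fact char_mul1 : left_id char_one char_mul.
Proof. by move=> x; apply: charvarP => a /=; rewrite mul1r. Qed.
Fact char_1mul : right_id char_one char_mul.
Proof. by move=> x; apply: charvarP => a /=; rewrite mulr1. Qed.
Fact char_mulV : left_inverse char_one char_inv char_mul.
Proof. by move=> x; apply: charvarP => a /=; rewrite mulVf ?char_neq0. Qed.
Fact char_Vmul : right_inverse char_one char_inv char_mul.
Proof. by move=> x; apply: charvarP => a /=; rewrite mulfV ?char_neq0. Qed.

HB.instance Definition _ :=
  isGroup.Build charvar char_mulA char_mul1 char_1mul char_mulV char_Vmul.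

(* The coordinate ring of the affine variety Hom(H, C^* ): the algebra
   generated by the evaluations x |-> x h.  As x (- h) = (x h)^-1, a basis
   e_1, ..., e_n of H identifies it with the Laurent polynomials in the
   z_i = x e_i. *)
Inductive regular : (charvar -> C) -> Prop :=
| regular_cst c : regular (fun=> c)
| regular_eval h : regular (fun x => x h)
| regular_add f g : regular f -> regular g -> regular (fun x => f x + g x)
| regular_mul f g : regular f -> regular g -> regular (fun x => f x * g x).

(* For affine varieties, morphisms are the maps pulling regular functions back
   to regular functions. *)
Definition algebraic (phi : charvar -> charvar) : Prop :=
  forall f, regular f -> regular (f \o phi).

Definition variety_aut_pred : {pred bij charvar} :=
  [pred f : bij charvar | `[< algebraic f /\ algebraic (bij_inv f) >]].

Lemma variety_aut_closed : group_closed variety_aut_pred.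
Proof.
split=> [|f g]; first by apply/asboolP; split.
move=> /asboolP[fA f'A] /asboolP[gA g'A]; apply/asboolP; split=> u ru.
  exact: g'A (fA _ ru).
exact: f'A (gA _ ru).
Qed.

Record variety_aut := VarietyAut {
  variety_aut_bij :> bij charvar;
  _ : variety_aut_bij \in variety_aut_pred }.
HB.instance Definition _ := [isSub for variety_aut_bij].
HB.instance Definition _ := [Choice of variety_aut by <:].
HB.instance Definition _ :=
  SubChoice_isSubGroup.Build _ _ variety_aut variety_aut_closed.

(* Z-linearity is additivity. *)
Definition zmod_aut_pred : {pred bij H} :=
  [pred f : bij H | `[< {morph f : a b / a + b} >]].

Lemma zmod_aut_closed : group_closed zmod_aut_pred.
Proof.
split=> [|f g]; first by apply/asboolP.
move=> /asboolP fD /asboolP gD; apply/asboolP => x y /=.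
by rewrite -fD; congr (f _); apply: (can_inj (bij_funK g)); rewrite gD !bij_invK.
Qed.

Record zmod_aut :=
  ZmodAut { zmod_aut_bij :> bij H; _ : zmod_aut_bij \in zmod_aut_pred }.
HB.instance Definition _ := [isSub for zmod_aut_bij].
HB.instance Definition _ := [Choice of zmod_aut by <:].
HB.instance Definition _ :=
  SubChoice_isSubGroup.Build _ _ zmod_aut zmod_aut_closed.

Lemma zmod_autD (f : zmod_aut) : {morph f : a b / a + b}.
Proof. exact/asboolP/(valP f). Qed.

Fact char_compD (x : charvar) (f : zmod_aut) a b :
  x (f (a + b)) = x (f a) * x (f b).
Proof. by rewrite zmod_autD charD. Qed.
Definition char_comp (f : zmod_aut) (x : charvar) :=
  @CharVar (x \o f) (fun a => char_neq0 x (f a)) (char_compD x f).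

Fact char_compK f : cancel (char_comp f^-1%g) (char_comp f).
Proof. by move=> x; apply: charvarP => a /=; rewrite bij_funK. Qed.
Fact char_compVK f : cancel (char_comp f) (char_comp f^-1%g).
Proof. by move=> x; apply: charvarP => a /=; rewrite bij_invK. Qed.
Definition char_act_bij (f : zmod_aut) : bij charvar :=
  Bij (char_compK f) (char_compVK f).

Fact char_act_aut f : char_act_bij f \in @group_aut_pred charvar.
Proof. by apply/asboolP => x y; exact: charvarP. Qed.

(* gamma . x = x \o gamma^-1 *)
Definition char_act (f : zmod_aut) : group_aut charvar :=
  GroupAut (char_act_aut f).

Fact char_act_mul : {morph char_act : f g / (f * g)%g}.
Proof. by move=> f g; apply/val_inj/bijP => x; exact: charvarP. Qed.

HB.instance Definition _ :=
  isMultiplicative.Build zmod_aut (group_aut charvar) char_act char_act_mul.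

End CharacterVariety.
Arguments char_act : clear implicits.

(* Main.v *)
Require Import Defs.
From HB Require Import structures.
From mathcomp Require Import all_boot all_order all_algebra.
From mathcomp Require Import all_classical reals topology normedtype.
From mathcomp Require Import complex.

Set Implicit Arguments.
Unset Strict Implicit.
Unset Printing Implicit Defensive.

(** Write H for the free abelian group H_1(X, Z) and T for the torus
    Hom(H, C^* ), whose regular functions are the linear combinations of the
    evaluations [x |-> x h], h in H: the Laurent polynomials on T.  Every pair
    (t, gamma) in T x Aut H gives the algebraic automorphism
    [x |-> t * (x \o gamma^-1)], and composing these maps is multiplying in the
    semi-direct product.  As the evaluations separate the points of H, (t, gamma)
    can be read off the map, and what remains is that every algebraic
    automorphism [phi] of T has this form.

    The reason is that the only units of the ring of regular functions are the
    monomials [x |-> c * x k] ([regular_unit]).  Since [x h] has inverse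
    [x (- h)], the pullback of an evaluation by [phi] is a unit, so
    [phi x h = c h * x (b h)] with [c h = phi 1 h].  Multiplicativity in [h]
    makes [b] additive, the inverse of [phi] gives an inverse of [b], and [phi]
    is the map attached to (phi 1, b^-1) ([variety_aut_affine]).

    The units are found by restricting to one variable.  For a linear form
    [w : H -> Z] and a nonzero scalar u, [h |-> u ^ w h] is a point of T, so a
    regular function restricts to a Laurent polynomial in u.  When [w] is
    injective on the support of the function ([weight_separates]), the
    restriction has the same coefficients, each at its own exponent.  An
    equation f * g = 1 restricts to p * q = 'X^m between polynomials; divisors
    of 'X^m are monomials, so the support of f is a single point. *)

Import Order.TTheory GRing.Theory Num.Theory.
Local Open Scope ring_scope.

(** * Univariate polynomials *)

(** The points k.+1 are nonzero, so that Laurent polynomials can be evaluated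
    there. *)
Lemma poly_eq0_natS (K : numDomainType) (p : {poly K}) :
  (forall k, root p k.+1%:R) -> p = 0.
Proof.
move=> rp; apply: (@roots_geq_poly_eq0 _ _ [seq k.+1%:R | k <- iota 0 (size p)]).
- by apply/allP => _ /mapP[k _ ->].
- rewrite map_inj_in_uniq ?iota_uniq // => i j _ _ /eqP.
  by rewrite eqr_nat => /eqP[].
- by rewrite size_map size_iota.
Qed.

Lemma dvdp_Xn_monomial (K : fieldType) (p : {poly K}) m :
  p %| 'X^m -> exists c i, c != 0 /\ p = c *: 'X^i.
Proof.
have -> : 'X^m = ('X - 0%:P) ^+ m :> {poly K} by rewrite subr0.
move=> /dvdp_exp_XsubCP[i _]; rewrite subr0 => /eqpf_eq[c c0 ->].
by exists c, i.
Qed.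

(** * Linear forms on the lattice and one-parameter families of characters *)

Lemma char0 (C : fieldType) (H : zmodType) (x : charvar C H) : x 0 = 1.
Proof. by apply: (mulfI (char_neq0 x 0)); rewrite -charD mulr1 addr0. Qed.

Section Weights.
Variables (H : zmodType) (n : nat) (coords : {additive H -> 'rV[int]_n}).
Hypothesis coords_inj : injective coords.

(** Kronecker substitution: seen as polynomials through their coordinates, the
    differences of distinct elements of [s] have a nonzero product, and [w] is
    the evaluation at an integer that is not a root of it. *)
Lemma weight_separates (s : seq H) :
  exists w : {additive H -> int}, {in s &, injective w}.
Proof.
pose q h := rVpoly (coords h).
have qB a b : q (a - b) = q a - q b by rewrite /q !raddfB.
pose P := \prod_(a <- s) \prod_(b <- s | a != b) q (a - b).
have P0 : P != 0.
  rewrite prodf_seq_neq0; apply/allP => a _ /=.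
  rewrite prodf_seq_neq0; apply/allP => b _ /=.
  apply/implyP; rewrite qB subr_eq0; apply: contraNN => /eqP.
  by move=> /(can_inj rVpolyK)/coords_inj ->.
have [k Pk] : exists k, ~~ root P k.+1%:R.
  apply: contrapT => /forallNP Pr; case/eqP: P0.
  by apply: poly_eq0_natS => k; apply/negPn/negP/Pr.
exists (horner_eval k.+1%:R \o rVpoly \o coords) => a b sa sb /= wab.
apply/eqP; apply: contraNT Pk => ab.
rewrite /P (big_rem a) //= (big_rem b) //= ab !rootM; apply/orP; left.
by apply/orP; left; rewrite rootE qB hornerD hornerN subr_eq0; apply/eqP.
Qed.

Section Characters.
Variable C : numFieldType.
Local Notation T := (charvar C H).

Section OneParameter.
Variables (u : C) (u0 : u != 0) (w : {additive H -> int}).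

Fact one_param_neq0 h : u ^ w h != 0. Proof. exact: expfz_neq0. Qed.
Fact one_paramD a b : u ^ w (a + b) = u ^ w a * u ^ w b.
Proof. by rewrite raddfD expfzDr. Qed.
Definition one_param : T := CharVar one_param_neq0 one_paramD.

End OneParameter.

(** A nonzero linear form on a - b gives a character of value a power of 2 other
    than 1. *)
Lemma char_separates (a b : H) : (forall x : T, x a = x b) -> a = b.
Proof.
move=> xab; have [w wI] := weight_separates [:: a; b].
have two0 : (2 : C) != 0 by rewrite pnatr_eq0.
apply: wI; rewrite ?inE ?eqxx ?orbT //.
have /eqP : (2 : C) ^ (w a - w b) = 1.
  rewrite expfzDr // [2 ^ w a](xab (one_param two0 w)) -expfzDr // subrr.
  exact: expr0z.
by rewrite pexprz_eq1 ?ler0n // pnatr_eq1 orbF subr_eq0 => /eqP.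
Qed.

(** * Regular functions and their units *)

Lemma regular_expansion (f : T -> C) : regular f ->
  exists (s : seq H) (a : H -> C), [/\ uniq s, {in s, forall h, a h != 0} &
    forall x, f x = \sum_(h <- s) a h * x h].
Proof.
move=> rf; have [l fE] : exists l : seq (C * H),
    forall x, f x = \sum_(p <- l) p.1 * x p.2.
  elim: f / rf => [c|h|f g _ [l fE] _ [m gE]|f g _ [l fE] _ [m gE]].
  - by exists [:: (c, 0)] => x; rewrite big_seq1 char0 mulr1.
  - by exists [:: (1, h)] => x; rewrite big_seq1 mul1r.
  - by exists (l ++ m) => x; rewrite big_cat fE gE.
  - exists [seq (p.1 * q.1, p.2 + q.2) | p <- l, q <- m] => x.
    rewrite fE gE big_allpairs_dep mulr_suml; apply: eq_bigr => p _.
    by rewrite mulr_sumr; apply: eq_bigr => q _; rewrite charD mulrACA.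
(* Group the terms with the same evaluation. *)
pose a h := \sum_(p <- l | p.2 == h) p.1.
exists [seq h <- undup [seq p.2 | p <- l] | a h != 0], a; split=> [|h|x].
- by rewrite filter_uniq ?undup_uniq.
- by rewrite mem_filter => /andP[].
have -> : \sum_(h <- [seq h <- undup [seq p.2 | p <- l] | a h != 0]) a h * x h
    = \sum_(h <- undup [seq p.2 | p <- l])
        \sum_(p <- l) (if p.2 == h then p.1 * x h else 0).
  rewrite big_filter big_mkcond; apply: eq_bigr => h _.
  rewrite -big_mkcond -mulr_suml -/(a h).
  by case: eqP => [->|//]; rewrite mul0r.
rewrite fE exchange_big /=; apply: eq_big_seq => p lp.
rewrite (bigD1_seq p.2) ?undup_uniq ?mem_undup ?map_f //= eqxx.
by rewrite big1 ?addr0 // => h /negPf; rewrite eq_sym => ->.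
Qed.

(** A Laurent polynomial in one variable, cleared of denominators.  Distinct
    weights keep the coefficients apart, so [p] remembers [a]; the function [e]
    is the shift of [w] that makes the exponents nonnegative. *)
Lemma laurent_poly (s : seq H) (a : H -> C) (w : H -> int) :
  uniq s -> {in s &, injective w} ->
  exists (m : nat) (e : H -> nat) (p : {poly C}),
  [/\ {in s &, injective e}, {in s, forall h, p`_(e h) = a h},
      forall i, i \notin [seq e h | h <- s] -> p`_i = 0 &
      forall u, u != 0 -> p.[u] = u ^+ m * \sum_(h <- s) a h * u ^ w h].
Proof.
move=> us wI; pose m := (\sum_(h <- s) `|w h|)%N.
have wm h : h \in s -> 0 <= w h + m.
  move=> sh; rewrite -lerBlDr sub0r.
  rewrite lerNl; apply: (@le_trans _ _ `|w h|%N%:Z).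
    by rewrite abszE -normrN ler_norm.
  by rewrite lez_nat /m (big_rem h) //= leq_addr.
pose e h := absz (w h + m); exists m, e, (\sum_(h <- s) a h *: 'X^(e h)).
have eI : {in s &, injective e}.
  move=> h k sh sk /(congr1 Posz); rewrite !gez0_abs ?wm // => /addIr.
  exact: wI.
split=> // [h sh|i|u u0].
- rewrite coef_sum (bigD1_seq h) //= coefZ coefXn eqxx mulr1 big1_seq ?addr0 //.
  move=> k /andP[kh sk]; rewrite coefZ coefXn (inj_in_eq eI) //.
  by rewrite eq_sym (negPf kh) mulr0.
- move=> si; rewrite coef_sum big1_seq // => h /= sh.
  rewrite coefZ coefXn; case: eqP => [ie|]; last by rewrite mulr0.
  by rewrite ie map_f in si.
- rewrite horner_sum mulr_sumr; apply: eq_big_seq => h sh.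
  rewrite hornerZ hornerXn mulrCA; congr (_ * _).
  by rewrite !exprnP gez0_abs ?wm // addrC expfzDr.
Qed.

(** Along the one-parameter family attached to a form [w] that is injective on
    the supports of [f] and [g], the relation f * g = 1 becomes a factorization
    of a power of 'X, whose factor coming from [f] is therefore a monomial. *)
Lemma regular_unit (f g : T -> C) : regular f -> regular g ->
  (forall x, f x * g x = 1) ->
  exists h c, forall x, f x = c * x h.
Proof.
move=> /regular_expansion[s [a [us a0 fE]]] /regular_expansion[t [b [ut b0 gE]]].
move=> fg; have [w wI] := weight_separates (s ++ t).
have wIs : {in s &, injective w}.
  by move=> h k sh sk; apply: wI; rewrite mem_cat ?sh ?sk.
have wIt : {in t &, injective w}.
  by move=> h k th tk; apply: wI; rewrite mem_cat ?th ?tk orbT.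
have [m [e [p [eI pa p0 pE]]]] := laurent_poly a us wIs.
have [m' [_ [q [_ _ _ qE]]]] := laurent_poly b ut wIt.
have pq : p * q = 'X^(m + m').
  apply/eqP; rewrite -subr_eq0; apply/eqP/poly_eq0_natS => k.
  have k0 : k.+1%:R != 0 :> C by rewrite pnatr_eq0.
  rewrite rootE !hornerE pE // qE // exprD mulrACA.
  by rewrite -(fE (one_param k0 w)) -(gE (one_param k0 w)) fg mulr1 subrr.
have [c [i [c0 pi]]] : exists c i, c != 0 /\ p = c *: 'X^i.
  by apply: (@dvdp_Xn_monomial _ _ (m + m')); rewrite -pq dvdp_mulIl.
have pc j : (p`_j != 0) = (j == i).
  by rewrite pi coefZ coefXn mulf_eq0 negb_or c0 /= pnatr_eq0 eqb0 negbK.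
have /mapP[h sh ih] : i \in [seq e h | h <- s].
  by apply/negPn/negP => /p0/eqP; apply/negP; rewrite pc.
exists h, (a h) => x; rewrite fE (bigD1_seq h) //= big1_seq ?addr0 //.
move=> k /andP[kh sk]; case/eqP: kh; apply: eI => //; rewrite -ih.
by apply/eqP; rewrite -pc pa ?a0.
Qed.

(** * Algebraic automorphisms of the torus *)

Lemma algebraic_monomial (phi : T -> T) (c : H -> C) (b : H -> H) :
  (forall x h, phi x h = c h * x (b h)) -> algebraic phi.
Proof.
move=> phiE f; elim: f / => [d|h|f g _ rf _ rg|f g _ rf _ rg].
- exact: regular_cst.
- have -> : (fun x : T => x h) \o phi = (fun x => c h * x (b h)).
    by apply/funext => x /=.
  apply: (@regular_mul C H (fun=> c h) (fun x => x (b h))).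
    exact: regular_cst.
  exact: regular_eval.
- exact: regular_add rf rg.
- exact: regular_mul rf rg.
Qed.

(** The value at the trivial character identifies the coefficient. *)
Lemma variety_aut_pullback (phi : variety_aut C H) :
  exists b : H -> H, forall (x : T) h, phi x h = phi (char_one C H) h * x (b h).
Proof.
suff /choice[b E] : forall h, exists k, forall x : T,
    phi x h = phi (char_one C H) h * x k by exists b.
move=> h; have [phiA _] : algebraic phi /\ algebraic (bij_inv phi).
  exact/asboolP/(valP phi).
have [|k [c E]] := regular_unit (phiA _ (regular_eval _ h))
                                (phiA _ (regular_eval _ (- h))).
  by move=> x /=; rewrite -charD subrr char0.
by exists k => x; rewrite [phi x h]E [phi _ h]E mulr1.
Qed.

(** Substituting [chi y] for [x] gives [y h = d * y (b' (b h))] with a constant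
    [d], which is 1 by taking [y] trivial. *)
Lemma pullback_exponentK (phi chi : T -> T) (b b' : H -> H) :
  (forall (x : T) h, phi x h = phi (char_one C H) h * x (b h)) ->
  (forall (x : T) h, chi x h = chi (char_one C H) h * x (b' h)) ->
  cancel chi phi -> cancel b b'.
Proof.
move=> bE b'E chiK h; apply: char_separates => x.
have E (y : T) : y h =
    phi (char_one C H) h * chi (char_one C H) (b h) * y (b' (b h)).
  by rewrite -{1}(chiK y) bE b'E mulrA.
have := E (char_one C H); rewrite /= mulr1 => d1.
by rewrite [RHS]E -d1 mul1r.
Qed.

Lemma variety_aut_affine (phi : variety_aut C H) :
  exists (t : T) (f : zmod_aut H), forall x : T, phi x = (t * char_act C H f x)%g.
Proof.
have [b bE] := variety_aut_pullback phi.
have [b' b'E] := variety_aut_pullback phi^-1%g.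
have bK := pullback_exponentK bE b'E (bij_invK phi).
have b'K := pullback_exponentK b'E bE (bij_funK phi).
have bD : {morph b : h k / h + k}.
  move=> h k; apply: char_separates => x.
  have := charD (phi x) h k; rewrite (bE x) (bE x h) (bE x k) mulrACA.
  by rewrite -!charD => /(mulfI (char_neq0 _ _)).
(* The action is by the inverse, so the automorphism of H is b^-1, that is b'. *)
have fP : Defs.Bij b'K bK \in @zmod_aut_pred H.
  by apply/asboolP => h k /=; apply: (can_inj bK); rewrite bD !b'K.
by exists (phi (char_one C H)), (ZmodAut fP) => x; apply: charvarP => h /=.
Qed.

(** * The semi-direct product *)

Local Notation S := (semidirect (char_act C H)).

Definition translation_bij (t : T) : Defs.bij T := Defs.Bij (mulKg t) (mulVKg t).

Fact affine_bij_subproof (s : S) :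
  bij_mul (translation_bij (sd_l s)) (char_act C H (sd_r s))
    \in @variety_aut_pred C H.
Proof.
apply/asboolP; split.
  by apply: (algebraic_monomial (c := sd_l s) (b := bij_inv (sd_r s))).
(* The inverse is x |-> (t^-1 * x) \o gamma. *)
exact: (algebraic_monomial (c := fun h => (sd_l s (sd_r s h))^-1) (b := sd_r s)).
Qed.
Definition affine_aut (s : S) : variety_aut C H :=
  VarietyAut (affine_bij_subproof s).

Fact affine_autM : {morph affine_aut : s t / (s * t)%g}.
Proof.
move=> s t; apply/val_inj/bijP => x; apply: charvarP => h.
by rewrite [RHS]mulrA.
Qed.
HB.instance Definition _ :=
  isMultiplicative.Build S (variety_aut C H) affine_aut affine_autM.

(** The value at the trivial character is [t]; the rest is [char_separates]. *)
Lemma affine_aut_inj : injective affine_aut.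
Proof.
move=> [t f] [t' f'] E.
have {}E (x : T) : (t * char_act C H f x = t' * char_act C H f' x)%g.
  by have /= := congr1 (fun phi : variety_aut C H => phi x) E.
have tt : t = t' by have := E 1%g; rewrite !group_aut1 !mulg1.
rewrite -{t'}tt in E *; congr SemiDirect.
apply/(can_inj invgK)/val_inj/bijP => h; apply: char_separates => x.
by have /(congr1 (fun y : T => y h)) := mulgI _ _ _ (E x).
Qed.

Lemma affine_aut_bij : bijective affine_aut.
Proof.
have /choice[G GK] : forall phi, exists s, affine_aut s = phi.
  move=> phi; have [t [f E]] := variety_aut_affine phi.
  by exists (SemiDirect _ t f); apply/val_inj/bijP => x; rewrite E.
by exists G => //; exact: inj_can_sym GK affine_aut_inj.
Qed.

End Characters.
End Weights.

Theorem theorem1p3 (R : realType) (X : riemann_surface R) (g : nat)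
  (X_compact : compact [set: X]%classic)
  (X_connected : connected [set: X]%classic)
  (X_genus : has_genus X g) (g_ge1 : (1 <= g)%N) :
  exists Phi : {multiplicative semidirect (char_act R[i] (H1 R X)) ->
                               variety_aut R[i] (H1 R X)},
    bijective Phi /\
    forall (s : semidirect (char_act R[i] (H1 R X))) (psi : charvar R[i] (H1 R X)),
      Phi s psi = (sd_l s * char_act R[i] (H1 R X) (sd_r s) psi)%g.
Proof.
have [coords /bij_inj coords_inj] := X_genus.
exists (@affine_aut (H1 R X) R[i]); split=> //.
exact: affine_aut_bij coords_inj _.
Qed.
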